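(* Let $m\ge 1$. For the direct product $P_2\times P_m$ of the path $P_2$ of order $2$ and the path $P_m$ of order $m$, the harmonic centralization is $$C_{\mathcal H}(P_2\times P_m)=\begin{cases}\dfrac{4\Big((m-1)H_{\frac{m-1}{2}}-H_{m-1}-\sum\limits_{j=2}^{\frac{m-1}{2}}\big(H_{j-1}+H_{m-j}\big)\Big)}{(m-1)(2m-1)} & \text{if } m \text{ is odd},\\[4mm] \dfrac{4\Big((m-2)\big(H_{\frac{m-2}{2}}+\frac1m\big)-H_{m-1}-\sum\limits_{j=2}^{\frac{m-2}{2}}\big(H_{j-1}+H_{m-j}\big)\Big)}{(m-1)(2m-1)} & \text{if } m \text{ is even}.\end{cases}$$
   Context: All graphs are simple, undirected and finite. For a nontrivial graph $G$ of order $n$ (number of vertices) and a vertex $u$, the harmonic centrality of $u$ is $\mathcal{H}_G(u)=\frac{\mathcal{R}_G(u)}{n-1}$, where $\mathcal{R}_G(u)=\sum_{x\in V(G),\,x\ne u}\frac{1}{d(u,x)}$, $d$ is the shortest-path distance in $G$, and $\frac{1}{d(u,x)}=0$ if there is no path from $u$ to $x$. The harmonic centralization of a graph $G$ of order $n$ is $$C_{\mathcal H}(G)=\frac{\sum_{x\in V(G)}\big(\mathcal{H}_{G,\max}-\mathcal{H}_G(x)\big)}{\frac{n-2}{2}},\qquad \mathcal{H}_{G,\max}=\max_{x\in V(G)}\mathcal{H}_G(x).$$ $H_n=\sum_{k=1}^n \frac1k$ is the $n$-th harmonic number; empty sums are $0$, as usual (so $H_0=0$). The direct product $G\times H$ has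 vertex set $V(G)\times V(H)$, with $(u,v)$ and $(u',v')$ adjacent iff $u,u'$ are adjacent in $G$ and $v,v'$ are adjacent in $H$.
   Formalization: The case m = 2 is excluded: P_2 × P_2 is two disjoint edges, so its harmonic centralization is 0, while the printed even formula gives −4/3. At m = 1, where both sides divide by zero, the identity holds only by the convention x/0 = 0. *)

(* Defs.v *)
From mathcomp Require Import all_boot all_order all_algebra.

Set Implicit Arguments.
Unset Strict Implicit.
Unset Printing Implicit Defensive.

Import Order.TTheory GRing.Theory Num.Theory.
Local Open Scope ring_scope.

Record sgraph := SGraph {
  vertex :> finType;
  adj : rel vertex;
  adj_sym : symmetric adj;
  adj_irrefl : irreflexive adj
}.

Section Distance.
Variable G : sgraph.
Implicit Types x y : G.

Definition walk (k : nat) x y : bool :=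
  [exists p : k.-tuple G, path (@adj G) x p && (last x p == y)].

(* Shortest-path distance: a shortest path has fewer than #|G| edges, so the
   search range suffices. The value is #|G| when y is not reachable from x. *)
Definition dist x y : nat := find (fun k => walk k x y) (iota 0 #|G|).

Lemma walkP k x y :
  reflect (exists p, [/\ path (@adj G) x p, last x p = y & size p = k])
          (walk k x y).
Proof.
apply: (iffP existsP) => [[p /andP[pp /eqP lp]]|[p [pp lp /eqP sp]]].
  by exists p; rewrite size_tuple.
by exists (Tuple sp); rewrite /= pp lp eqxx.
Qed.

Lemma walk_short k x y : walk k x y -> exists2 l, (l < #|G|)%N & walk l x y.
Proof.
case/walkP=> p [pp lp _]; case/shortenP: pp lp => q pq uq _ lq.
exists (size q); last by apply/walkP; exists q.
by have /card_uniqP /= <- := uq; apply: max_card.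
Qed.

Lemma dist_le k x y : walk k x y -> (dist x y <= k)%N.
Proof.
move=> wk; rewrite leqNgt; apply/negP => ltk.
have kG : (k < #|G|)%N.
  by apply: leq_trans ltk _; rewrite -[leqRHS](size_iota 0) find_size.
by have := before_find 0%N ltk; rewrite nth_iota // add0n wk.
Qed.

Lemma walk_dist x y : connect (@adj G) x y -> walk (dist x y) x y.
Proof.
case/connectP=> p pp lp.
have /walk_short[l lG wl] : walk (size p) x y by apply/walkP; exists p.
have hw : has (fun k => walk k x y) (iota 0 #|G|).
  by apply/hasP; exists l; rewrite // mem_iota.
have := nth_find 0%N hw; rewrite nth_iota //.
by rewrite -[ltnRHS](size_iota 0) -has_find.
Qed.

End Distance.

Section Centrality.
Variables (R : realFieldType) (G : sgraph).

Definition recip_dist (x y : G) : R :=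
  if connect (@adj G) x y then (dist x y)%:R^-1 else 0.

Definition recip_dist_sum (u : G) : R := \sum_(x : G | x != u) recip_dist u x.

Definition harmonic_centrality (u : G) : R :=
  recip_dist_sum u / (#|G|%:R - 1).

(* The default value 0 is harmless, centralities being nonnegative. *)
Definition harmonic_centrality_max : R :=
  \big[Order.max/0]_(x : G) harmonic_centrality x.

Definition harmonic_centralization : R :=
  (\sum_(x : G) (harmonic_centrality_max - harmonic_centrality x))
  / ((#|G|%:R - 2) / 2).

End Centrality.

Definition path_adj (m : nat) : rel 'I_m :=
  [rel i j : 'I_m | (i.+1 == j :> nat) || (j.+1 == i :> nat)].

Lemma path_adj_sym m : symmetric (@path_adj m).
Proof. by move=> i j; rewrite /path_adj /= orbC. Qed.

Lemma path_adj_irrefl m : irreflexive (@path_adj m).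
Proof. by move=> i; rewrite /path_adj /= orbb eqn_leq ltnn. Qed.

Definition path_graph (m : nat) : sgraph :=
  SGraph (@path_adj_sym m) (@path_adj_irrefl m).

Section DirectProduct.
Variables G H : sgraph.

Definition direct_adj : rel (G * H)%type :=
  [rel p q | adj p.1 q.1 && adj p.2 q.2].

Lemma direct_adj_sym : symmetric direct_adj.
Proof. by move=> p q; rewrite /direct_adj /= adj_sym [adj p.2 _]adj_sym. Qed.

Lemma direct_adj_irrefl : irreflexive direct_adj.
Proof. by move=> p; rewrite /direct_adj /= adj_irrefl. Qed.

Definition direct_product : sgraph := SGraph direct_adj_sym direct_adj_irrefl.

End DirectProduct.

Definition harmonic_number (R : realFieldType) (n : nat) : R :=
  \sum_(1 <= k < n.+1) k%:R^-1.

(* Main.v *)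
(* An edge of P_2 x P_m changes both coordinates by 1, so two vertices are
   connected exactly when their coordinate sums have the same parity, and then
   their distance is the difference of the second coordinates: the product is
   two disjoint copies of P_m. With i counted from 0, the reciprocal distance
   sum of (a, i) is therefore H_i + H_(m-1-i); as harmonic numbers are concave,
   it is largest at the centre, and it is invariant under i |-> m-1-i. *)
Require Import Defs.
From mathcomp Require Import all_boot all_order all_algebra.
From mathcomp Require Import zify ring lra.

Set Implicit Arguments.
Unset Strict Implicit.
Unset Printing Implicit Defensive.

Import Order.TTheory GRing.Theory Num.Theory.
Local Open Scope ring_scope.

Section HarmonicNumber.
Variable R : realFieldType.
Local Notation H := (harmonic_number R).

Lemma harmonic_numberE n : H n = \sum_(i < n) i.+1%:R^-1.
Proof. by rewrite /harmonic_number big_add1 big_mkord. Qed.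

Lemma harmonic_number0 : H 0 = 0.
Proof. by rewrite harmonic_numberE big_ord0. Qed.

Lemma harmonic_numberS n : H n.+1 = H n + n.+1%:R^-1.
Proof. by rewrite !harmonic_numberE big_ord_recr. Qed.

Lemma harmonic_number_ge0 n : 0 <= H n.
Proof. by rewrite harmonic_numberE sumr_ge0 // => i _; rewrite invr_ge0. Qed.

(** Concavity of the harmonic numbers: each unit of [e] adds [1/(d+e+1)] on the left and the larger
    [1/(a+e+1)] on the right. *)
Lemma harmonic_number_balance a d e :
  (a <= d)%N -> H a + H (d + e) <= H (a + e) + H d.
Proof.
move=> ad; elim: e => [|e IHe]; first by rewrite !addn0.
have le_inv : (d + e).+1%:R^-1 <= (a + e).+1%:R^-1 :> R.
  by rewrite lef_pV2 ?posrE ?ltr0n // ler_nat ltnS leq_add2r.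
by rewrite !addnS !harmonic_numberS addrA [leRHS]addrAC lerD.
Qed.

(** The bounds on [c] say that it is half of [n], rounded down. Reflection lets [i] lie in the lower
    half; then [i] and [n - i] both move inward by [c - i]. *)
Lemma harmonic_number_pair_le n c i :
  (i <= n)%N -> (c <= n - c <= c.+1)%N -> H i + H (n - i) <= H c + H (n - c).
Proof.
move=> le_in /andP[le_c le_nc].
wlog le_ic : i le_in / (i <= c)%N.
  move=> IH; case: (leqP i c) => [|lt_ci]; first exact: IH.
  have := IH (n - i)%N (leq_subr _ _); rewrite subKn // addrC; apply; lia.
have := @harmonic_number_balance i (n - c) (c - i) ltac:(lia).
by rewrite subnKC // (_ : n - c + (c - i) = n - i)%N //; lia.
Qed.

Lemma sum_dist_inv m (i : 'I_m) :
  \sum_(j < m) (i - j + (j - i))%:R^-1 = H i + H (m - 1 - i) :> R.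
Proof.
have lt_im := ltn_ord i.
rewrite -(big_mkord xpredT (fun j => (i - j + (j - i))%:R^-1 : R)).
(* Split at [j = i], where the term is [0^-1 = 0]; the part before it, reversed, gives [H i], the
   part after it [H (m - 1 - i)]. *)
rewrite (@big_cat_nat _ _ _ i) //=; last exact: ltnW.
rewrite [X in _ + X]big_ltn // subnn addn0 invr0 add0r; congr (_ + _).
  rewrite big_nat_rev big_mkord harmonic_numberE; apply: eq_bigr => j _ /=.
  by congr (_%:R^-1); have := ltn_ord j; lia.
rewrite -{1}[i.+1]add0n big_addn big_mkord harmonic_numberE.
rewrite (_ : m - i.+1 = m - 1 - i)%N; last by lia.
by apply: eq_bigr => j _; congr (_%:R^-1); lia.
Qed.

End HarmonicNumber.

Lemma sum_palindrome (V : nmodType) (F : nat -> V) n k :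
    (forall i, (i < k)%N -> F (n - i.+1)%N = F i) -> (k + k <= n)%N ->
  \sum_(i < n) F i = (\sum_(i < k) F i) *+ 2 + \sum_(k <= i < n - k) F i.
Proof.
move=> symF le_kn.
rewrite -(big_mkord xpredT F) (@big_cat_nat _ _ _ k) //=; last by lia.
rewrite (@big_cat_nat _ _ _ (n - k)%N k n) /=; [|lia|lia].
rewrite mulr2n -addrA big_mkord; congr (_ + _); rewrite addrC; congr (_ + _).
rewrite big_nat_rev /= -{1}[(n - k)%N]add0n big_addn.
rewrite (_ : n - (n - k) = k)%N ?big_mkord; last by lia.
apply: eq_bigr => i _; rewrite -[RHS]symF //; congr F.
by have := ltn_ord i; lia.
Qed.

Section PathProduct.
Variable m : nat.
Local Notation G := (direct_product (path_graph 2) (path_graph m)).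
(** One of the two truncated differences is zero, so this is the absolute difference. *)
Local Notation gap x y := (x.2 - y.2 + (y.2 - x.2))%N.

Let parity (x : 'I_2 * 'I_m) := odd (x.1 + x.2).

Lemma adj_parity (x y : G) : adj x y -> parity x = parity y.
Proof.
case: x y => [a i] [b j]; rewrite /= /direct_adj /parity /= /path_adj /=.
by lia.
Qed.

Lemma path_parity (x : G) p : path (@adj G) x p -> parity x = parity (last x p).
Proof.
by elim: p x => //= y p IHp x /andP[/adj_parity-> /IHp].
Qed.

Lemma path_gap (x : G) p :
  path (@adj G) x p -> (gap x (last x p) <= size p)%N.
Proof.
elim: p x => [|y p IHp] x /=; first by lia.
case/andP=> /andP[_ xy] /IHp; move: xy.
rewrite /= /path_adj /=; move: (last y p) => z; lia.
Qed.

(** With gap 0, equal parity forces the first coordinates to agree too; otherwise one edge towards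
    [y] lowers the gap by 1. *)
Lemma walk_gap (x y : G) : parity x = parity y -> walk (gap x y) x y.
Proof.
move Ek: (gap x y) => k; elim: k x Ek => [|k IHk] x Ek xy.
  apply/walkP; exists [::]; split=> //=.
  case: x y xy Ek => [a i] [b j]; rewrite /parity /= => xy Ek.
  have := ltn_ord a; have := ltn_ord b => *.
  by congr (_, _); apply: val_inj => /=; lia.
have [z xz Ez] : exists2 z : G, adj x z & gap z y = k.
  case: x y {IHk} xy Ek => [a i] [b j]; rewrite /parity /= => xy Ek.
  have lt_a := ltn_ord a; have lt_j := ltn_ord j; have lt_i := ltn_ord i.
  (* The neighbour [z] flips the first coordinate and moves the second one step towards [j]. *)
  have lt_c : (1 - a < 2)%N by lia.
  have lt_l : ((if i < j then i.+1 else i.-1) < m)%N by case: ifP; lia.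
  exists (Ordinal lt_c, Ordinal lt_l); last by rewrite /=; case: ifP; lia.
  by rewrite /= /direct_adj /= /path_adj /=; case: ifP; lia.
have /walkP[p [zp lp sp]] := IHk z Ez (etrans (esym (adj_parity xz)) xy).
by apply/walkP; exists (z :: p); split; [apply/andP | | rewrite /= sp].
Qed.

Lemma connect_path_product (x y : G) :
  connect (@adj G) x y = (parity x == parity y).
Proof.
apply/idP/eqP => [/connectP[p xp ->]|/walk_gap /walkP[p [xp <- _]]].
  exact: path_parity.
by apply/connectP; exists p.
Qed.

Lemma dist_path_product (x y : G) : parity x = parity y -> dist x y = gap x y.
Proof.
move=> xy; apply/eqP; rewrite eqn_leq dist_le ?walk_gap //=.
have /walk_dist/walkP[p [xp <- <-]] : connect (@adj G) x y.
  by rewrite connect_path_product; apply/eqP.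
exact: path_gap.
Qed.

Variable R : realFieldType.
Local Notation H := (harmonic_number R).

Lemma recip_dist_sum_path_product (x : G) :
  recip_dist_sum R x = H x.2 + H (m - 1 - x.2).
Proof.
rewrite -sum_dist_inv /recip_dist_sum.
(* The vertex [x] itself may be included, since [0^-1 = 0]. *)
transitivity (\sum_(y : G) recip_dist R x y).
  rewrite [RHS](bigD1 x) //= {2}/recip_dist connect0 dist_path_product //.
  by rewrite subnn invr0 add0r.
transitivity (\sum_(a : 'I_2) \sum_(j < m) recip_dist R x ((a, j) : G)).
  by rewrite pair_bigA; apply: eq_bigr => -[].
rewrite exchange_big; apply: eq_bigr => j _ /=.
have recipE (a : 'I_2) : recip_dist R x ((a, j) : G) =
    if parity x == parity (a, j) then (x.2 - j + (j - x.2))%:R^-1 else 0.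
  rewrite /recip_dist connect_path_product.
  by case: eqP => // xy; rewrite dist_path_product.
(* For each [j], exactly one of the two vertices [(a, j)] has the parity of [x]. *)
rewrite big_ord_recl big_ord1 !recipE /parity /= /bump /= add0n.
by case: (odd (x.1 + x.2)); case: (odd j); rewrite /= ?addr0 ?add0r.
Qed.

Lemma card_path_product : #|G| = (2 * m)%N.
Proof. by rewrite card_prod !card_ord. Qed.

Lemma harmonic_centrality_path_product (x : G) :
  harmonic_centrality R x = (H x.2 + H (m - 1 - x.2)) / (2 * m%:R - 1).
Proof.
by rewrite /harmonic_centrality recip_dist_sum_path_product card_path_product natrM.
Qed.

Lemma harmonic_centrality_max_path_product c :
    (0 < m)%N -> (c <= m - 1 - c <= c.+1)%N ->
  harmonic_centrality_max R G = (H c + H (m - 1 - c)) / (2 * m%:R - 1).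
Proof.
move=> m_gt0 hc.
have den_ge0 : 0 <= (2 * m%:R - 1 : R)^-1.
  have : 1 <= m%:R :> R by rewrite ler1n.
  by move=> ?; rewrite invr_ge0; lra.
rewrite /harmonic_centrality_max; apply/le_anti/andP; split.
  apply: bigmax_le => [|x _].
    (* The default value 0 of the maximum must also respect the bound. *)
    by rewrite mulr_ge0 // addr_ge0 // harmonic_number_ge0.
  rewrite harmonic_centrality_path_product ler_wpM2r //.
  by apply: harmonic_number_pair_le => //; have := ltn_ord x.2; lia.
have lt_cm : (c < m)%N by lia.
have := le_bigmax 0 (@harmonic_centrality R G) ((ord0, Ordinal lt_cm) : G).
by rewrite harmonic_centrality_path_product.
Qed.

Lemma harmonic_centralization_path_product c :
    (0 < m)%N -> (c <= m - 1 - c <= c.+1)%N ->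
  harmonic_centralization R G =
  2 * (m%:R * (H c + H (m - 1 - c)) - \sum_(i < m) (H i + H (m - 1 - i)))
    / ((m%:R - 1) * (2 * m%:R - 1)).
Proof.
move=> m_gt0 hc; rewrite /harmonic_centralization.
rewrite (harmonic_centrality_max_path_product _ hc) // card_path_product natrM.
set M := H c + _; set D := 2 * m%:R - 1.
have -> : (2 * m%:R - 2) / 2 = m%:R - 1 :> R by field.
transitivity ((\sum_(a < 2) \sum_(i < m) (M / D - (H i + H (m - 1 - i)) / D))
    / (m%:R - 1)).
  congr (_ / _); rewrite pair_bigA; apply: eq_bigr => x _.
  by rewrite harmonic_centrality_path_product.
rewrite big_const_ord iter_addr_0 sumrB sumr_const card_ord -mulr_suml.
(* At [m = 1] the factor [m - 1] is 0; [invfM] covers this through [0^-1 = 0]. *)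
by rewrite -[(M / D) *+ m]mulr_natl -mulr_natl invfM; ring.
Qed.

End PathProduct.

Theorem theorem3p10 (R : realFieldType) (m : nat) (m_ge1 : (1 <= m)%N)
    (m_neq2 : m != 2%N) :
  harmonic_centralization R (direct_product (path_graph 2) (path_graph m)) =
  if odd m then
    4 * ((m%:R - 1) * harmonic_number R ((m - 1) %/ 2)
         - harmonic_number R (m - 1)
         - \sum_(2 <= j < ((m - 1) %/ 2).+1)
              (harmonic_number R (j - 1) + harmonic_number R (m - j)))
    / ((m%:R - 1) * (2 * m%:R - 1))
  else
    4 * ((m%:R - 2) * (harmonic_number R ((m - 2) %/ 2) + 1 / m%:R)
         - harmonic_number R (m - 1)
         - \sum_(2 <= j < ((m - 2) %/ 2).+1)
              (harmonic_number R (j - 1) + harmonic_number R (m - j)))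
    / ((m%:R - 1) * (2 * m%:R - 1)).
Proof.
set H := harmonic_number R; pose F i := H i + H (m - 1 - i)%N.
(* The term [j = 1] of the formula is [H_(m-1)], as [H_0 = 0]. *)
have sumF k : (0 < k)%N || (m == 1%N) ->
    H (m - 1)%N + \sum_(2 <= j < k.+1) (H (j - 1)%N + H (m - j)%N)
    = \sum_(i < k) F i.
  (* For [k = 0] we have [m = 1], and [H (m - 1)] vanishes. *)
  case: k => [/= /eqP->|k _].
    by rewrite big_geq // big_ord0 subnn /H harmonic_number0 addr0.
  rewrite -(big_mkord xpredT F) big_ltn // {1}/F /H harmonic_number0 add0r subn0.
  rewrite [in LHS]big_add1; congr (_ + _); apply: eq_big_nat => j _.
  by rewrite /F; congr (H _ + H _); lia.
have splitF k : (k + k <= m)%N ->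
    \sum_(i < m) F i = (\sum_(i < k) F i) *+ 2 + \sum_(k <= i < m - k) F i.
  move=> km; apply: sum_palindrome => // i ik.
  by rewrite /F addrC; congr (H _ + H _); lia.
case: ifP => odd_m.
  (* A single central index [k] remains between the halves, with [F k = 2 * H k]. *)
  set k := ((m - 1) %/ 2)%N; have mk : m = (2 * k + 1)%N by rewrite /k; lia.
  rewrite (@harmonic_centralization_path_product m R k) //; last by lia.
  rewrite (splitF k); last by lia.
  rewrite (_ : m - k = k.+1)%N; last by lia.
  rewrite big_nat1 -(sumF k); last by lia.
  rewrite {1}/F (_ : m - 1 - k = k)%N -/H; last by lia.
  by congr (_ / _); ring.
set k := ((m - 2) %/ 2)%N; have mk : m = (2 * k.+1)%N by rewrite /k; lia.
(* At [m = 2] the sum over [i < k] is empty, yet the formula would still subtract [H 1 = 1]. *)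
have k_gt0 : (0 < k)%N by move/eqP: m_neq2; lia.
rewrite (@harmonic_centralization_path_product m R k) //; last by lia.
(* The halves, of [k + 1] terms each, leave no middle. Their last term
   [F k = H k + H k.+1 = 2 * (H k + 1 / m)] is also the maximum, which turns the factor [m] into
   [m - 2]. *)
rewrite (splitF k.+1) ?(@big_geq _ _ _ k.+1 (m - k.+1)); [|lia|lia].
rewrite big_ord_recr /= -(sumF k); last by lia.
rewrite /F (_ : m - 1 - k = k.+1)%N /H ?harmonic_numberS -/H; last by lia.
have mR : m%:R = 2 * k.+1%:R :> R by rewrite [in LHS]mk natrM.
have k_neq0 : k.+1%:R != 0 :> R by rewrite pnatr_eq0.
by rewrite mR; congr (_ / _); move: k.+1%:R k_neq0 => q q_neq0; field.
Qed.
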